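(* Let $G$ be a finite connected undirected graph with vertices $v_1,\dots,v_n$ whose adjacency matrix $A(G)$ has Perron–Frobenius eigenvalue $\lambda_1>0$ satisfying $|\mu|<\lambda_1$ for every other eigenvalue $\mu$ of $A(G)$. Let $\Gamma$ be a group, let $\gamma:V(G)\to\Gamma$, $t_m=\gamma(v_m)$, and assume that the set $S^{-1}S=\{t_a^{-1}t_b : 1\le a,b\le n\}$ generates $\Gamma$. Assume that $\Gamma$ has property $(\tau)$ with respect to representations with finite image, with respect to the generating set $S^{-1}S$: there is $\kappa>0$ such that for every nontrivial irreducible unitary representation $\rho$ of $\Gamma$ on a finite-dimensional Hilbert space $H$ with $\rho(\Gamma)$ finite, and every unit vector $u\in H$, there is $s\in S^{-1}S$ with $\|\rho(s)u-u\|>\kappa$. Then there exist constants $C>0$ and $0<c<1$ such that for every homomorphism $\psi:\Gamma\to\Gamma'$ with finite image $\psi(\Gamma)$, every $1\le i,j\le n$, every $N\ge 1$ and every $\nu\in\psi(\Gamma)$, \[ \left| p^{\psi}_{N,i,j}(\nu) - \frac{1}{|\psi(\Gamma)|}\right| \le C\,c^{N}. \] In particular the exponential rate of convergence of $F^\psi_{N,i,j}$ to the uniform distribution on $\psi(\Gamma)$ is bounded independently of $\psi$.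
   Context: A walk of length $N$ from $v_i$ to $v_j$ is a sequence of vertices $w_0=v_i,w_1,\dots,w_N=v_j$ with $w_{m-1}$ adjacent to $w_m$ for all $m$ (counted with the multiplicities given by the entries of $A(G)$); $W_{N,i,j}$ denotes the set of such walks. For a walk $w$, $\gamma(w)=\gamma(w_0)\gamma(w_1)\cdots\gamma(w_{N-1})$ (product in order). $F^\psi_{N,i,j}$ is the probability distribution on $\psi(\Gamma)$ given by $p^{\psi}_{N,i,j}(\nu)=|\{w\in W_{N,i,j}:\psi(\gamma(w))=\nu\}|/|W_{N,i,j}|$. *)

(* Defs.v *)
From HB Require Import structures.
From mathcomp Require Import all_boot all_order all_algebra.
From mathcomp Require Import reals.
From mathcomp.real_closed Require Import complex.
Set Implicit Arguments. Unset Strict Implicit. Unset Printing Implicit Defensive.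
Import Order.TTheory GRing.Theory Num.Theory.
Local Open Scope ring_scope.

Definition is_group_hom (G H : groupType) (f : G -> H) : Prop :=
  forall x y : G, f (x * y)%g = (f x * f y)%g.

Definition generates (G : groupType) (X : G -> Prop) : Prop :=
  forall H : G -> Prop,
    H 1%g -> (forall x y, H x -> H y -> H (x * y)%g) -> (forall x, H x -> H (x^-1)%g) ->
    (forall x, X x -> H x) -> forall g, H g.

Definition SinvS (G : groupType) n (t : 'I_n -> G) : G -> Prop :=
  fun s => exists a b : 'I_n, s = ((t a)^-1 * t b)%g.

(* a walk of length N is a map w : 'I_N.+1 -> 'I_n (w_0, ..., w_N);
   its multiplicity is prod_{m<N} A(w_m, w_{m+1}) *)
Definition walk_weight n (A : 'M[nat]_n) N (w : {ffun 'I_N.+1 -> 'I_n}) : nat :=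
  (\prod_(m < N) A (w (inord m)) (w (inord m.+1)))%N.

Definition walk_label (G : groupType) n (t : 'I_n -> G) N
    (w : {ffun 'I_N.+1 -> 'I_n}) : G :=
  \big[monoid.mul/1%g]_(m < N) t (w (inord m)).

Definition nwalks_P n (A : 'M[nat]_n) N (i j : 'I_n)
    (P : {ffun 'I_N.+1 -> 'I_n} -> bool) : nat :=
  (\sum_(w : {ffun 'I_N.+1 -> 'I_n} | [&& w ord0 == i, w ord_max == j & P w])
      walk_weight A w)%N.

Definition nwalks n (A : 'M[nat]_n) N (i j : 'I_n) : nat :=
  nwalks_P A i j (fun _ : {ffun 'I_N.+1 -> 'I_n} => true).

Definition pwalk (R : realType) (G H : groupType) n (A : 'M[nat]_n)
    (t : 'I_n -> G) (psi : G -> H) N (i j : 'I_n) (nu : H) : R :=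
  (nwalks_P A i j (fun w : {ffun 'I_N.+1 -> 'I_n} => psi (walk_label t w) == nu))%:R
    / (nwalks A N i j)%:R.

Definition connected_adj n (A : 'M[nat]_n) : Prop :=
  forall i j : 'I_n, exists N, (0 < nwalks A N i j)%N.

Definition PF_gap (R : realType) n (A : 'M[nat]_n) : Prop :=
  exists lambda1 : R,
    0 < lambda1 /\ eigenvalue (map_mx (fun k : nat => k%:R) A) lambda1 /\
    forall mu : R, eigenvalue (map_mx (fun k : nat => k%:R) A) mu ->
      mu != lambda1 -> `|mu| < lambda1.

Definition vnorm (R : realType) d (u : 'cV[R[i]]_d) : R[i] :=
  sqrtC (\sum_(k < d) `|u k 0| ^+ 2).

Definition is_rep (R : realType) (G : groupType) d (rho : G -> 'M[R[i]]_d) : Prop :=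
  rho 1%g = 1%:M /\ forall x y : G, rho (x * y)%g = rho x *m rho y.

Definition unitary_rep (R : realType) (G : groupType) d (rho : G -> 'M[R[i]]_d) : Prop :=
  forall g : G, rho g *m (map_mx Num.conj (rho g))^T = 1%:M.

Definition finite_image (R : realType) (G : groupType) d (rho : G -> 'M[R[i]]_d) : Prop :=
  exists s : seq 'M[R[i]]_d, forall g : G, rho g \in s.

Definition subspace (R : realType) d (W : 'cV[R[i]]_d -> Prop) : Prop :=
  W 0 /\ (forall u v, W u -> W v -> W (u + v)) /\ (forall (c : R[i]) u, W u -> W (c *: u)).

Definition irreducible_rep (R : realType) (G : groupType) d (rho : G -> 'M[R[i]]_d) : Prop :=
  (0 < d)%N /\
  forall W : 'cV[R[i]]_d -> Prop, subspace W ->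
    (forall g u, W u -> W (rho g *m u)) ->
    (forall u, W u -> u = 0) \/ (forall u, W u).

Definition nontrivial_rep (R : realType) (G : groupType) d (rho : G -> 'M[R[i]]_d) : Prop :=
  exists g : G, rho g != 1%:M.

Definition property_tau_finite (R : realType) (G : groupType) (X : G -> Prop) : Prop :=
  exists kappa : R, 0 < kappa /\
    forall (d : nat) (rho : G -> 'M[R[i]]_d),
      is_rep rho -> unitary_rep rho -> finite_image rho ->
      irreducible_rep rho -> nontrivial_rep rho ->
      forall u : 'cV[R[i]]_d, vnorm u = 1 ->
        exists s : G, X s /\ real_complex R kappa < vnorm (rho s *m u - u).

(* Main.v *)
(** Count walks by their first step.  With [Z_N(i, .)] the weighted number of
    walks of length [N] from [v_i] to [v_j] as a function of the label in
    [Q = psi(Gamma)], one gets [Z_(N+1) = D (A Z_N)], where [D] is the isometry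
    translating the [k]-th component by [psi(t_k)].  (Splitting off the last
    step instead would produce [t_a t_b^-1] rather than [t_a^-1 t_b].)

    Off the Perron vector [v], [A] contracts by [mu < lam].  On [v (x) h] with
    [h] of mean zero, [D] followed by projection to [v] gives the average
    [sum_k v_k^2 (psi(t_k) h)], which is shorter than [h] by a definite factor:
    the norms of the differences [psi(t_a) h - psi(t_b) h] are bounded below
    by property (tau).  Hence [A D A] has norm at most [sqrt eta * lam^2] on
    mean-zero vectors, with [eta < 1] depending on [A] and [kappa] only.  As the
    number of walks grows like [lam^N v_i v_j], the deviation from the uniform
    distribution decays exponentially, uniformly in [psi]. *)

Require Import Defs.
From HB Require Import structures.
From mathcomp Require Import all_boot all_order all_algebra.
From mathcomp Require Import boolp spectral reals.
From mathcomp.real_closed Require Import complex.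
From mathcomp Require Import ring lra.
Set Implicit Arguments. Unset Strict Implicit. Unset Printing Implicit Defensive.
Import Order.TTheory GRing.Theory Num.Theory.
Local Open Scope ring_scope.

(** * Recursion of weighted walk counts on the first step *)

Section Walks.

Variables (n : nat).

Definition fcons N (k : 'I_n) (w : {ffun 'I_N.+1 -> 'I_n}) : {ffun 'I_N.+2 -> 'I_n} :=
  [ffun x => if unlift ord0 x is Some y then w y else k].

Lemma fcons0 N k (w : {ffun 'I_N.+1 -> 'I_n}) : fcons k w ord0 = k.
Proof. by rewrite ffunE unlift_none. Qed.

Lemma fcons_lift N k (w : {ffun 'I_N.+1 -> 'I_n}) y : fcons k w (lift ord0 y) = w y.
Proof. by rewrite ffunE liftK. Qed.

Lemma fcons_inordS N k (w : {ffun 'I_N.+1 -> 'I_n}) m :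
  (m < N.+1)%N -> fcons k w (inord m.+1) = w (inord m).
Proof.
move=> ltmN; have -> : inord m.+1 = lift ord0 (inord m) :> 'I_N.+2.
  by apply/val_inj; rewrite /= !inordK.
exact: fcons_lift.
Qed.

Lemma fcons_max N k (w : {ffun 'I_N.+1 -> 'I_n}) : fcons k w ord_max = w ord_max.
Proof.
have -> : ord_max = lift ord0 ord_max :> 'I_N.+2 by apply/val_inj.
exact: fcons_lift.
Qed.

Lemma inord0 N : inord 0 = ord0 :> 'I_N.+1.
Proof. by apply/val_inj; rewrite /= inordK. Qed.

Lemma sum_fcons N (P : pred {ffun 'I_N.+2 -> 'I_n}) (F : {ffun 'I_N.+2 -> 'I_n} -> nat) :
  (\sum_(w | P w) F w = \sum_k \sum_(w | P (fcons k w)) F (fcons k w))%N.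
Proof.
rewrite (reindex (fun p : 'I_n * {ffun 'I_N.+1 -> 'I_n} => fcons p.1 p.2)) /=.
  by rewrite pair_big_dep.
exists (fun w => (w ord0, [ffun y => w (lift ord0 y)])) => [[k w] _|w _] /=.
  by rewrite fcons0; congr pair; apply/ffunP => y; rewrite ffunE fcons_lift.
apply/ffunP => x; rewrite ffunE; case: unliftP => [y ->|->] //; by rewrite ffunE.
Qed.

Variable A : 'M[nat]_n.

Lemma walk_weight_fcons N k (w : {ffun 'I_N.+1 -> 'I_n}) :
  walk_weight A (fcons k w) = (A k (w ord0) * walk_weight A w)%N.
Proof.
rewrite /walk_weight big_ord_recl; congr (_ * _)%N.
  by rewrite fcons_inordS // !inord0 fcons0.
apply: eq_bigr => m _; have lt1 := ltn_ord m.
by rewrite !fcons_inordS // ?ltnS // ltnW.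
Qed.

Lemma walk_label_fcons (G : groupType) (t : 'I_n -> G) N k (w : {ffun 'I_N.+1 -> 'I_n}) :
  walk_label t (fcons k w) = (t k * walk_label t w)%g.
Proof.
rewrite /walk_label big_ord_recl; congr (_ * _)%g.
  by rewrite inord0 fcons0.
apply: eq_bigr => m _; rewrite fcons_inordS //.
by rewrite ltnW // ltnS.
Qed.

Lemma eq_nwalks_P N i j (P Q : {ffun 'I_N.+1 -> 'I_n} -> bool) :
  P =1 Q -> nwalks_P A i j P = nwalks_P A i j Q.
Proof. by move=> eqPQ; apply: eq_bigl => w; rewrite eqPQ. Qed.

(** Only sequences starting at [i] survive, and grouping the tails by their initial vertex [k]
    extracts the factor [A i k]. An arbitrary predicate is carried along so that total counts and
    label counts obey the same recursion. *)
Lemma nwalks_P_recl N i j (P : {ffun 'I_N.+2 -> 'I_n} -> bool) :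
  nwalks_P A i j P = (\sum_k A i k * nwalks_P A k j (fun w => P (fcons i w)))%N.
Proof.
rewrite /nwalks_P sum_fcons (bigD1 i) //= [X in (_ + X)%N]big1 => [|k nki]; last first.
  by rewrite big_pred0 // => w; rewrite fcons0 (negPf nki).
rewrite addn0.
under eq_bigl => w do rewrite fcons0 eqxx fcons_max /=.
rewrite (partition_big (fun w : {ffun 'I_N.+1 -> 'I_n} => w ord0) xpredT) //=.
apply: eq_bigr => k _; rewrite big_distrr /=; apply: eq_big => [w|w /andP[_ /eqP wk]].
  by rewrite andbC.
by rewrite walk_weight_fcons wk.
Qed.

Lemma nwalks_P0 i j (P : {ffun 'I_1 -> 'I_n} -> bool) :
  nwalks_P A i j P = ((i == j) && P [ffun=> i]).
Proof.
rewrite /nwalks_P.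
have Ew (w : {ffun 'I_1 -> 'I_n}) : w = [ffun=> w ord0].
  by apply/ffunP => x; rewrite ffunE ord1.
rewrite (eq_bigl (fun w => [&& w == [ffun=> i], i == j & P [ffun=> i]])); last first.
  move=> w; have -> : ord_max = ord0 :> 'I_1 by apply/val_inj.
  have -> : (w == [ffun=> i]) = (w ord0 == i).
    by apply/eqP/eqP => [->|wi]; rewrite ?ffunE // (Ew w) wi.
  by case: eqP => //= wi; rewrite {2}(Ew w) wi.
case: (_ && P _) => /=; last by rewrite big_pred0 // => w; rewrite andbF.
under eq_bigl do rewrite andbT.
by rewrite big_pred1_eq /walk_weight big_ord0.
Qed.

End Walks.

(** * Frobenius norms and the two-step contraction estimate *)

Section Contraction.

Variable R : realFieldType.

(** The squared Frobenius norm. Matrices of size [(n, q)] stand for elements of the tensor product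
    of [R^n] and [R^q]. *)
Definition nrm2 m n (F : 'M[R]_(m, n)) : R := \tr (F^T *m F).

Lemma nrm2E m n (F : 'M[R]_(m, n)) : nrm2 F = \sum_i \sum_j F i j ^+ 2.
Proof.
rewrite exchange_big; apply: eq_bigr => j _ /=; rewrite mxE.
by apply: eq_bigr => i _; rewrite mxE expr2.
Qed.

Lemma nrm2_ge0 m n (F : 'M[R]_(m, n)) : 0 <= nrm2 F.
Proof. by rewrite nrm2E; do 2![apply: sumr_ge0 => ? _]; exact: sqr_ge0. Qed.

Lemma nrm2_eq0 m n (F : 'M[R]_(m, n)) : nrm2 F = 0 -> F = 0.
Proof.
rewrite nrm2E => /eqP; rewrite psumr_eq0 => [/allP F0|i _]; last first.
  by apply: sumr_ge0 => ? _; exact: sqr_ge0.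
apply/matrixP => i j; have := F0 i (mem_index_enum _).
rewrite psumr_eq0 => [/allP /(_ j (mem_index_enum _))|? _]; last exact: sqr_ge0.
by rewrite /= sqrf_eq0 mxE => /eqP.
Qed.

Lemma nrm2_entry m n (F : 'M[R]_(m, n)) i j : F i j ^+ 2 <= nrm2 F.
Proof.
rewrite nrm2E (bigD1 i) //= (bigD1 j) //= -addrA lerDl addr_ge0 //.
  by apply: sumr_ge0 => ? _; exact: sqr_ge0.
by apply: sumr_ge0 => ? _; apply: sumr_ge0 => ? _; exact: sqr_ge0.
Qed.

Lemma nrm2Z m n a (F : 'M[R]_(m, n)) : nrm2 (a *: F) = a ^+ 2 * nrm2 F.
Proof. by rewrite /nrm2 [(a *: F)^T]linearZ -scalemxAl -scalemxAr !mxtraceZ mulrA expr2. Qed.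

Lemma nrm2_tr m n (F : 'M[R]_(m, n)) : nrm2 F^T = nrm2 F.
Proof. by rewrite /nrm2 trmxK mxtrace_mulC. Qed.

Lemma nrm2_row m n (F : 'M[R]_(m, n)) : nrm2 F = \sum_i nrm2 (row i F).
Proof.
rewrite nrm2E; apply: eq_bigr => i _; rewrite nrm2E big_ord1.
by apply: eq_bigr => j _; rewrite mxE.
Qed.

Lemma nrm2_col m n (F : 'M[R]_(m, n)) : nrm2 F = \sum_j nrm2 (col j F).
Proof. by rewrite -nrm2_tr nrm2_row; apply: eq_bigr => j _; rewrite -tr_col nrm2_tr. Qed.

Lemma nrm2D_ortho m n (X Y : 'M[R]_(m, n)) :
  X^T *m Y = 0 -> nrm2 (X + Y) = nrm2 X + nrm2 Y.
Proof.
move=> XY0; have YX0 : Y^T *m X = 0 by rewrite -[X]trmxK -trmx_mul XY0 trmx0.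
by rewrite /nrm2 [(X + Y)^T]linearD mulmxDl !mulmxDr XY0 YX0 addr0 add0r mxtraceD.
Qed.

(** Young's inequality: entrywise the gap is [s^-1 * (s * x - y) ^+ 2]. The free parameter [s] is
    tuned in the contraction estimate. *)
Lemma nrm2D_le m n (X Y : 'M[R]_(m, n)) (s : R) : 0 < s ->
  nrm2 (X + Y) <= (1 + s) * nrm2 X + (1 + s^-1) * nrm2 Y.
Proof.
move=> s_gt0; rewrite !nrm2E !mulr_sumr -big_split /=; apply: ler_sum => i _.
rewrite !mulr_sumr -big_split /=; apply: ler_sum => j _; rewrite mxE.
set x := X i j; set y := Y i j; rewrite -subr_ge0.
rewrite (_ : _ - _ = s^-1 * (s * x - y) ^+ 2); last by field; rewrite gt_eqF.
by rewrite mulr_ge0 ?sqr_ge0 // invr_ge0 ltW.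
Qed.

Lemma nrm2_mulmx_orth m n (X : 'M[R]_(m, n)) (P : 'M[R]_n) :
  P *m P^T = 1%:M -> nrm2 (X *m P) = nrm2 X.
Proof.
move=> PP; rewrite /nrm2 mxtrace_mulC trmx_mul mulmxA.
by rewrite -[X *m _ *m _]mulmxA PP mulmx1 mxtrace_mulC.
Qed.

Lemma nrm2_mul_unit m n (v : 'cV[R]_m) (h : 'rV[R]_n) :
  v^T *m v = 1%:M -> nrm2 (v *m h) = nrm2 h.
Proof. by move=> vv; rewrite /nrm2 trmx_mul mulmxA -[_ *m v^T *m v]mulmxA vv mulmx1. Qed.

Lemma nrm2_proj m n (v : 'cV[R]_m) (F : 'M[R]_(m, n)) : v^T *m v = 1%:M ->
  nrm2 F = nrm2 (v^T *m F) + nrm2 (F - v *m (v^T *m F)).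
Proof.
move=> vv; rewrite -(nrm2_mul_unit _ vv) -nrm2D_ortho; first by rewrite addrC subrK.
have v0 : v^T *m (F - v *m (v^T *m F)) = 0.
  by rewrite mulmxBr [v^T *m (v *m _)]mulmxA vv mul1mx subrr.
by rewrite [(v *m _)^T]trmx_mul -mulmxA v0 mulmx0.
Qed.

(** The variance identity in each coordinate: a variance is half the mean square difference of two
    independent copies. It turns the distances between the [x k] into an exact loss of norm under
    averaging. *)
Lemma nrm2_convex n q (p : 'I_n -> R) (x : 'I_n -> 'rV[R]_q) : \sum_k p k = 1 ->
  nrm2 (\sum_k p k *: x k) = \sum_k p k * nrm2 (x k)
    - 2^-1 * \sum_a \sum_b p a * p b * nrm2 (x a - x b).
Proof.
move=> p1.
have nrmr (y : 'rV[R]_q) : nrm2 y = \sum_j y 0 j ^+ 2 by rewrite nrm2E big_ord1.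
rewrite nrmr; under [X in _ = X - _]eq_bigr do rewrite nrmr mulr_sumr.
under [X in _ = _ - _ * X]eq_bigr => a _ do
  under eq_bigr => b _ do rewrite nrmr mulr_sumr.
rewrite exchange_big /=; under [X in _ = _ - _ * X]eq_bigr do rewrite exchange_big /=.
rewrite [X in _ = _ - _ * X]exchange_big /= mulr_sumr -sumrB; apply: eq_bigr => j _.
have -> : (\sum_k p k *: x k) 0 j = \sum_k p k * x k 0 j.
  by rewrite summxE; apply: eq_bigr => k _; rewrite mxE.
set s := \sum_k p k * x k 0 j; set u := \sum_k p k * x k 0 j ^+ 2.
suff -> : \sum_a \sum_b p a * p b * (x a - x b) 0 j ^+ 2 = 2 * (u - s ^+ 2) by field.
have -> : 2 * (u - s ^+ 2) = \sum_a p a * (x a 0 j ^+ 2 + u - 2 * x a 0 j * s).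
  rewrite (eq_bigr (fun a => p a * x a 0 j ^+ 2 + p a * u - p a * x a 0 j * (2 * s))).
    by rewrite sumrB big_split /= -!mulr_suml p1 -/u -/s; ring.
  by move=> a _; ring.
apply: eq_bigr => a _.
rewrite (eq_bigr (fun b => p b * (p a * x a 0 j ^+ 2) + p a * (p b * x b 0 j ^+ 2)
    - (p b * x b 0 j) * (2 * p a * x a 0 j))) => [|b _]; last by rewrite !mxE; ring.
by rewrite sumrB big_split /= -!mulr_suml -mulr_sumr p1 -/u -/s; ring.
Qed.

(** The operator [D]: each row is moved by its own matrix, whereas [A] acts by left multiplication
    and mixes the rows. *)
Definition rowact n q (Pi : 'I_n -> 'M[R]_q) (F : 'M[R]_(n, q)) : 'M[R]_(n, q) :=
  \matrix_k (row k F *m Pi k).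

Lemma rowactD n q (Pi : 'I_n -> 'M[R]_q) F G :
  rowact Pi (F + G) = rowact Pi F + rowact Pi G.
Proof.
apply/row_matrixP => k; rewrite linearD /= !rowK linearD /=; exact: mulmxDl.
Qed.

Lemma nrm2_rowact n q (Pi : 'I_n -> 'M[R]_q) F :
  (forall k, Pi k *m (Pi k)^T = 1%:M) -> nrm2 (rowact Pi F) = nrm2 F.
Proof.
move=> PiO; rewrite nrm2_row [RHS]nrm2_row; apply: eq_bigr => k _.
by rewrite rowK nrm2_mulmx_orth.
Qed.

(* Here [a] and [z] are the squared norms of the components of a vector along
   and off [v], [y] that of the image of the latter, and [p] that of the
   projection to [v] after one step. *)
Lemma contraction_rate (lam mu b : R) : 0 <= mu -> mu < lam -> 0 <= b < 1 ->
  exists2 eta, 0 < eta < 1 & forall a z y p : R,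
    0 <= a -> 0 <= z -> y <= mu ^+ 2 * z -> p <= lam ^+ 2 * a + y ->
    (forall s, 0 < s -> p <= (1 + s) * (lam ^+ 2 * (b * a)) + (1 + s^-1) * y) ->
    (lam ^+ 2 - mu ^+ 2) * p + mu ^+ 2 * (lam ^+ 2 * a + y)
      <= eta * lam ^+ 4 * (a + z).
Proof.
move=> mu0 mulam /andP[b0 b1]; have lam0 : 0 < lam by exact: le_lt_trans mulam.
pose m := (mu / lam) ^+ 2.
have m0 : 0 <= m by exact: sqr_ge0.
have m1 : m < 1 by rewrite /m expr_lt1 ?divr_ge0 // ?ltr_pdivrMr ?mul1r // ltW.
have muE : mu ^+ 2 = m * lam ^+ 2 by rewrite /m exprMn exprVn divfK // expf_neq0 // gt_eqF.
(* This choice gives [(1 + th) * b <= 1 - th], which amounts to [0 <= (1 - b) ^+ 2]. *)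
pose th := (1 - b) / 2.
have th0 : 0 < th by rewrite /th; lra.
have thb : (1 + th) * b <= 1 - th by rewrite /th; nra.
have th1 : th <= 2^-1 by rewrite /th; lra.
have th2 : 0 < th ^+ 2 by exact: exprn_gt0.
have th21 : th ^+ 2 <= 1 by rewrite expr_le1 //; lra.
exists (1 - (1 - m) * th ^+ 2 / 2) => [|a z y p a0 z0 yz py /(_ th th0) pth]; first nra.
rewrite muE in yz *; set L := lam ^+ 2 in yz py pth *.
have -> : lam ^+ 4 = L ^+ 2 by rewrite /L -exprM.
have L0 : 0 < L by exact: exprn_gt0.
have thV : th / 2 * th^-1 = 2^-1 by field; rewrite gt_eqF.
have pb : p <= (1 - th ^+ 2 / 2) * (L * a) + (1 + 2^-1) * y.
  have La0 : 0 <= L * a by rewrite mulr_ge0 // ltW.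
  (* Averaging the two bounds on [p] with weights [1 - th / 2] and [th / 2] keeps the coefficient of
     [y] at [3 / 2]; the second bound alone would give [1 + th^-1]. *)
  have pb1 : p <= (1 - th / 2) * (L * a + y)
      + th / 2 * ((1 + th) * (L * (b * a)) + (1 + th^-1) * y) by nra.
  apply: le_trans pb1 _.
  have -> : (1 - th / 2) * (L * a + y) + th / 2 * ((1 + th) * (L * (b * a)) + (1 + th^-1) * y)
    = (1 - th / 2 + th / 2 * ((1 + th) * b)) * (L * a) + (1 + th / 2 * th^-1) * y by ring.
  rewrite thV lerD2r ler_wpM2r //; nra.
have L1m : 0 <= L - m * L by nra.
apply: (le_trans (lerD (ler_wpM2l L1m pb) (lexx _))).
have -> : (L - m * L) * ((1 - th ^+ 2 / 2) * (L * a) + (1 + 2^-1) * y) + m * L * (L * a + y)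
  = (1 - (1 - m) * th ^+ 2 / 2) * L ^+ 2 * a + (1 + (1 - m) / 2) * (L * y) by field.
rewrite mulrDr lerD2l.
have : L * y <= L * (m * L * z) by rewrite ler_wpM2l // ltW.
move=> Ly; have c0 : 0 <= 1 + (1 - m) / 2 by lra.
apply: (le_trans (ler_wpM2l c0 Ly)).
have -> : (1 + (1 - m) / 2) * (L * (m * L * z)) = ((1 + (1 - m) / 2) * m) * (L ^+ 2 * z) by ring.
(* As [th ^+ 2 <= 1], it suffices that [m * (3 - m) <= 1 + m], that is, [0 <= (1 - m) ^+ 2]. *)
rewrite -[leRHS]mulrA ler_wpM2r ?mulr_ge0 ?sqr_ge0 //; nra.
Qed.

Section Operator.

Variables (n : nat) (A : 'M[R]_n) (lam mu : R) (v : 'cV[R]_n).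
Hypotheses (Asym : A^T = A) (vv : v^T *m v = 1%:M) (Av : A *m v = lam *: v).
Hypothesis gap : forall w : 'cV[R]_n, v^T *m w = 0 -> nrm2 (A *m w) <= mu ^+ 2 * nrm2 w.

Lemma gap_mx q (F : 'M[R]_(n, q)) : v^T *m F = 0 -> nrm2 (A *m F) <= mu ^+ 2 * nrm2 F.
Proof.
move=> vF; rewrite nrm2_col [in leRHS]nrm2_col mulr_sumr; apply: ler_sum => j _.
by rewrite !colE -mulmxA gap // mulmxA vF mul0mx.
Qed.

Lemma trv_mulA : v^T *m A = lam *: v^T.
Proof. by rewrite -{1}Asym -trmx_mul Av linearZ. Qed.

(** By symmetry [A] preserves both the line of [v] and its orthogonal complement, so the images of
    the two components stay orthogonal. *)
Lemma nrm2_mulA q (F : 'M[R]_(n, q)) :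
  nrm2 (A *m F) = lam ^+ 2 * nrm2 (v^T *m F) + nrm2 (A *m (F - v *m (v^T *m F))).
Proof.
rewrite (nrm2_proj _ vv) // mulmxA trv_mulA -scalemxAl nrm2Z; congr (_ + nrm2 _).
by rewrite -scalemxAr mulmxBr [A *m (v *m _)]mulmxA Av -scalemxAl.
Qed.

Lemma nrm2_mulA_le q (F : 'M[R]_(n, q)) :
  nrm2 (A *m F) <= lam ^+ 2 * nrm2 (v^T *m F) + mu ^+ 2 * (nrm2 F - nrm2 (v^T *m F)).
Proof.
rewrite nrm2_mulA lerD2l (nrm2_proj F vv) // addrAC subrr add0r.
by apply: gap_mx; rewrite mulmxBr [v^T *m (v *m _)]mulmxA vv mul1mx subrr.
Qed.

Variables (q : nat) (Pi : 'I_n -> 'M[R]_q).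
Hypothesis PiO : forall k, Pi k *m (Pi k)^T = 1%:M.

Lemma trv_rowact (F : 'M[R]_(n, q)) :
  v^T *m rowact Pi F = \sum_k v k 0 *: (row k F *m Pi k).
Proof.
rewrite mulmx_sum_row; apply: eq_bigr => k _; by rewrite rowK mxE.
Qed.

Lemma sum_sqr_v : \sum_k v k 0 ^+ 2 = 1.
Proof.
have := congr1 (fun X : 'M_1 => X 0 0) vv; rewrite !mxE eqxx mulr1n => <-.
by apply: eq_bigr => k _; rewrite mxE expr2.
Qed.

(** The projected vector is the average of the [h *m Pi k] with weights [v k 0 ^+ 2], which sum to
    [1]. The variance identity gives the loss, each product of two weights being at least
    [eps ^+ 2]. *)
Lemma nrm2_average_le (eps kap : R) (h : 'rV[R]_q) :
  0 <= eps -> (forall k, eps <= v k 0 ^+ 2) ->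
  kap * nrm2 h <= \sum_a \sum_b nrm2 (h *m Pi a - h *m Pi b) ->
  nrm2 (v^T *m rowact Pi (v *m h)) <= (1 - eps ^+ 2 * kap / 2) * nrm2 h.
Proof.
move=> eps0 epsv hkap; rewrite trv_rowact.
under eq_bigr => k _ do rewrite row_mul rowE -rowE.
rewrite (eq_bigr (fun k => v k 0 ^+ 2 *: (h *m Pi k))); last first.
  move=> k _; rewrite (_ : row k v = (v k 0)%:M).
    by rewrite mul_scalar_mx -scalemxAl scalerA expr2.
  by apply/matrixP => i j; rewrite !ord1 !mxE eqxx mulr1n.
rewrite nrm2_convex ?sum_sqr_v //.
under eq_bigr => k _ do rewrite nrm2_mulmx_orth //.
rewrite -mulr_suml sum_sqr_v mul1r mulrBl mul1r lerD2l lerN2.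
rewrite -mulrA mulrAC [X in X <= _](_ : _ = 2^-1 * (eps ^+ 2 * (kap * nrm2 h))); last by field.
rewrite ler_wpM2l ?invr_ge0 //.
apply: (le_trans (ler_wpM2l (sqr_ge0 eps) hkap)).
rewrite mulr_sumr; apply: ler_sum => a _; rewrite mulr_sumr; apply: ler_sum => b _.
by rewrite ler_wpM2r ?nrm2_ge0 // expr2 ler_pM.
Qed.

End Operator.

(** One step [rowact Pi (A *m F)] scales the norm of [F = v *m h] by exactly [lam]; the gain appears
    only when the second [A] meets the shortened projection to [v]. That [eta] is chosen before [q]
    and [Pi] is the source of uniformity in [psi]. *)
Lemma two_step_contraction n (A : 'M[R]_n) (lam mu eps kap : R) (v : 'cV[R]_n) :
  A^T = A -> v^T *m v = 1%:M -> A *m v = lam *: v ->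
  0 <= mu -> mu < lam ->
  (forall w : 'cV[R]_n, v^T *m w = 0 -> nrm2 (A *m w) <= mu ^+ 2 * nrm2 w) ->
  0 < eps -> (forall k, eps <= v k 0 ^+ 2) -> 0 < kap ->
  exists2 eta, 0 < eta < 1 & forall q (Pi : 'I_n -> 'M[R]_q) (F : 'M[R]_(n, q)),
    (forall k, Pi k *m (Pi k)^T = 1%:M) ->
    (kap * nrm2 (v^T *m F) <=
      \sum_a \sum_b nrm2 (v^T *m F *m Pi a - v^T *m F *m Pi b)) ->
    nrm2 (A *m rowact Pi (A *m F)) <= eta * lam ^+ 4 * nrm2 F.
Proof.
move=> Asym vv Av mu0 mulam gap eps0 epsv kap0.
(* [kap] has no upper bound here, so the factor is truncated at [0] to meet the condition [0 <= b]
   of [contraction_rate]. *)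
pose b := Num.max 0 (1 - eps ^+ 2 * kap / 2).
have ek0 : 0 < eps ^+ 2 * kap by rewrite mulr_gt0 ?exprn_gt0.
have b01 : 0 <= b < 1 by rewrite le_max lexx gt_max ltr01 /=; lra.
have [eta eta01 rate] := contraction_rate mu0 mulam b01.
exists eta => // q Pi F PiO hF.
set h := v^T *m F in hF; set Z := F - v *m h.
have vZ : v^T *m Z = 0 by rewrite mulmxBr [v^T *m (v *m _)]mulmxA vv mul1mx subrr.
have nF : nrm2 F = nrm2 h + nrm2 Z by rewrite (nrm2_proj _ vv).
have nAF : nrm2 (A *m F) = lam ^+ 2 * nrm2 h + nrm2 (A *m Z).
  by rewrite (nrm2_mulA Asym vv Av).
have AFE : A *m F = v *m (lam *: h) + A *m Z.
  by rewrite mulmxBr [A *m (v *m _)]mulmxA Av -scalemxAl -scalemxAr addrC subrK.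
set W := rowact Pi (A *m F).
have nW : nrm2 W = lam ^+ 2 * nrm2 h + nrm2 (A *m Z) by rewrite nrm2_rowact.
have vle (G : 'M[R]_(n, q)) : nrm2 (v^T *m G) <= nrm2 G.
  by rewrite [leRHS](nrm2_proj _ vv) // lerDl nrm2_ge0.
apply: le_trans (nrm2_mulA_le Asym vv Av gap _) _.
rewrite -/W nW nF.
have -> (x y : R) : lam ^+ 2 * x + mu ^+ 2 * (y - x) = (lam ^+ 2 - mu ^+ 2) * x + mu ^+ 2 * y.
  by ring.
apply: rate => //; try exact: nrm2_ge0.
- exact: (gap_mx gap).
- by rewrite -nW.
(* Young's inequality separates the averaged part, coming from [v *m h], from the part coming from
   [Z], which is bounded by its full norm. *)
move=> s s0; rewrite /W AFE rowactD mulmxDr.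
apply: le_trans (nrm2D_le _ _ s0) _.
apply: lerD; last first.
  have s2 : 0 <= 1 + s^-1 by rewrite addr_ge0 // invr_ge0 ltW.
  by rewrite ler_wpM2l //; apply: le_trans (vle _) _; rewrite nrm2_rowact.
have s1 : 0 <= 1 + s by rewrite addr_ge0 // ltW.
rewrite ler_wpM2l //.
have hb : (1 - eps ^+ 2 * kap / 2) <= b by rewrite le_max lexx orbT.
apply: (@le_trans _ _ ((1 - eps ^+ 2 * kap / 2) * nrm2 (lam *: h))).
  apply: nrm2_average_le => //; first exact: ltW.
  rewrite nrm2Z mulrCA (le_trans (ler_wpM2l (sqr_ge0 lam) hF)) //.
  rewrite mulr_sumr; apply: ler_sum => i _; rewrite mulr_sumr; apply: ler_sum => j _.
  by rewrite -!scalemxAl -scalerBr nrm2Z.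
by rewrite nrm2Z mulrCA ler_wpM2l ?sqr_ge0 // ler_wpM2r // nrm2_ge0.
Qed.

End Contraction.

(** * Squared hermitian norms of complex vectors *)

Section ComplexNorm.

Variable R : rcfType.
Local Notation C := R[i].

(** The square of [vnorm]: it is additive over orthogonal summands and avoids square roots. *)
Definition cn2 d (u : 'cV[C]_d) : C := \sum_k `|u k 0| ^+ 2.

Lemma cn2E d (u : 'cV[C]_d) : cn2 u = ((map_mx Num.conj u)^T *m u) 0 0.
Proof. by rewrite mxE; apply: eq_bigr => k _; rewrite !mxE normCK mulrC. Qed.

Lemma cn2_ge0 d (u : 'cV[C]_d) : 0 <= cn2 u.
Proof. by apply: sumr_ge0 => k _; rewrite exprn_ge0. Qed.

Lemma cn2_eq0 d (u : 'cV[C]_d) : (cn2 u == 0) = (u == 0).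
Proof.
apply/eqP/eqP => [/eqP|->]; last by apply: big1 => k _; rewrite mxE normr0 expr0n.
rewrite psumr_eq0 => [/allP u0|k _]; last by rewrite exprn_ge0.
apply/colP => k; rewrite mxE; have := u0 k (mem_index_enum _).
by rewrite /= sqrf_eq0 normr_eq0 => /eqP.
Qed.

Lemma cn2Z d a (u : 'cV[C]_d) : cn2 (a *: u) = `|a| ^+ 2 * cn2 u.
Proof. by rewrite mulr_sumr; apply: eq_bigr => k _; rewrite mxE normrM exprMn. Qed.

Lemma cn2_isometry m d (U : 'M[C]_(m, d)) (u : 'cV[C]_d) :
  (map_mx Num.conj U)^T *m U = 1%:M -> cn2 (U *m u) = cn2 u.
Proof.
move=> UU; rewrite !cn2E map_mxM trmx_mul mulmxA.
by rewrite -[_ *m _ *m U]mulmxA UU mulmx1.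
Qed.

Lemma cn2_real d (w : 'cV[R]_d) : cn2 (map_mx (real_complex R) w) = real_complex R (nrm2 w).
Proof.
rewrite nrm2E rmorph_sum; apply: eq_bigr => k _ /=; rewrite big_ord1 mxE.
by rewrite normc_def /= expr0n addr0 sqrtr_sqr -rmorphXn /= real_normK ?num_real.
Qed.

End ComplexNorm.

(** * Spectral bounds for real symmetric matrices and the Perron vector *)

Section Perron.

Variable R : rcfType.
Local Notation C := R[i].
Local Notation toC := (real_complex R).

Lemma Re_mul_real (z : C) (a : R) : complex.Re (z * toC a) = complex.Re z * a.
Proof. by case: z => x y /=; rewrite mulr0 subr0. Qed.

Lemma Im_mul_real (z : C) (a : R) : complex.Im (z * toC a) = complex.Im z * a.
Proof. by case: z => x y /=; rewrite mulr0 add0r. Qed.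

Lemma Re_mulmx_real m n p (X : 'M[C]_(m, n)) (A : 'M[R]_(n, p)) :
  map_mx (@complex.Re R) (X *m map_mx toC A) = map_mx (@complex.Re R) X *m A.
Proof.
apply/matrixP => i j; rewrite !mxE raddf_sum; apply: eq_bigr => k _.
by rewrite !mxE /= Re_mul_real.
Qed.

Lemma Im_mulmx_real m n p (X : 'M[C]_(m, n)) (A : 'M[R]_(n, p)) :
  map_mx (@complex.Im R) (X *m map_mx toC A) = map_mx (@complex.Im R) X *m A.
Proof.
apply/matrixP => i j; rewrite !mxE raddf_sum; apply: eq_bigr => k _.
by rewrite !mxE /= Im_mul_real.
Qed.

(* [s] is the spectrum of the complexification of [A], whose eigenvectors are
   tested against the hypothesis through their real and imaginary parts. *)
Lemma symmetric_spectral_bound n (A : 'M[R]_n) : A^T = A ->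
  exists2 s : seq R, {in s, forall a, eigenvalue A a} &
    forall (mu : R) (w : 'cV[R]_n), 0 <= mu ->
    {in s, forall a, `|a| <= mu \/ forall x : 'rV[R]_n, x *m A = a *: x -> x *m w = 0} ->
    nrm2 (A *m w) <= mu ^+ 2 * nrm2 w.
Proof.
move=> Asym; pose AC := map_mx toC A.
have ACsym : AC \is symmetricmx.
  by apply/is_hermitianmxP; rewrite expr0 scale1r map_mx_id // /AC map_trmx Asym.
have ACreal : AC \is a mxOver Num.real.
  by apply/mxOverP => i j; rewrite mxE; apply/complex_realP; exists (A i j).
have /mxOverP dreal := hermitian_spectral_diag_real (realsym_hermsym ACsym ACreal).
have /orthomx_spectralP ACE := symmetric_normalmx ACsym ACreal.
have PU := spectral_unitarymx AC; have Punit := spectral_unit AC.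
set P := spectralmx AC in ACE PU Punit; set d := spectral_diag AC in ACE dreal.
have PA : P *m AC = diag_mx d *m P by rewrite {1}ACE !mulmxA mulmxV // mul1mx.
pose a k := complex.Re (d 0 k).
have aE k : toC (a k) = d 0 k by rewrite /a RRe_real.
have rowA k : row k P *m AC = d 0 k *: row k P.
  by rewrite -row_mul PA mul_diag_mx; apply/rowP => j; rewrite !mxE.
exists [seq a k | k <- enum 'I_n] => [_ /mapP[k _ ->]|mu w mu0 hs].
  (* Being an eigenvalue descends to [R] because [a k] is real, although row [k] of [P] is only a
     complex eigenvector. *)
  rewrite -(eigenvalue_map toC) /= aE; apply/eigenvalueP; exists (row k P) => //.
  apply/eqP => rk0; have : row_free P by rewrite row_free_unit.
  move=> /row_free_inj /(_ (delta_mx 0 k : 'rV_n) 0); rewrite -rowE rk0 mul0mx.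
  by move=> /(_ erefl) /rowP /(_ k); rewrite !mxE !eqxx => /eqP; rewrite oner_eq0.
have PtP : (map_mx Num.conj P)^T *m P = 1%:M.
  by apply: mulmx1C; rewrite map_trmx; exact/unitarymxP.
pose wC := map_mx toC w.
rewrite -lecR rmorphM rmorphXn /= -!cn2_real map_mxM -/AC -/wC.
rewrite -[cn2 (AC *m _)](cn2_isometry _ PtP) -[cn2 wC](cn2_isometry _ PtP).
rewrite mulmxA PA -mulmxA mulr_sumr; apply: ler_sum => k _.
rewrite mul_diag_mx mxE normrM exprMn.
(* In the orthonormal eigenbasis the bound holds coordinate by coordinate: either the eigenvalue is
   small or the coordinate of [w] vanishes. *)
have [le_a|w0] : `|a k| <= mu \/ (P *m wC) k 0 = 0.
- have [|h|h] := hs (a k); first by apply/mapP; exists k; rewrite ?mem_enum.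
    by left.
  right; have hRe : map_mx (@complex.Re R) (row k P) *m A = a k *: map_mx (@complex.Re R) (row k P).
    rewrite -Re_mulmx_real rowA -aE; apply/rowP => j; rewrite !mxE.
    by rewrite mulrC Re_mul_real mulrC.
  have hIm : map_mx (@complex.Im R) (row k P) *m A = a k *: map_mx (@complex.Im R) (row k P).
    rewrite -Im_mulmx_real rowA -aE; apply/rowP => j; rewrite !mxE.
    by rewrite mulrC Im_mul_real mulrC.
  have /matrixP /(_ 0 0) := h _ hRe; have /matrixP /(_ 0 0) := h _ hIm.
  rewrite -Re_mulmx_real -Im_mulmx_real -row_mul.
  rewrite mxE [row _ _ _ _]mxE -/wC [RHS]mxE => im0.
  rewrite mxE [row _ _ _ _]mxE -/wC [RHS]mxE => re0.
  by apply/eqP; rewrite eq_complex re0 im0 !eqxx.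
- apply: ler_wpM2r; first by rewrite exprn_ge0.
  rewrite -aE normc_def /= expr0n addr0 sqrtr_sqr -!rmorphXn lecR.
  by rewrite lerXn2r // nnegrE.
by rewrite w0 normr0 expr0n /= !mulr0.
Qed.

(** The spectral bound makes [lam] a bound for the norm of [A], so the entrywise absolute value of a
    [lam]-eigenvector is again one. Connectedness rules out zero entries, which yields both a
    positive eigenvector and the simplicity of [lam]; [mu] comes from the finitely many other
    eigenvalues. *)
Lemma perron_frobenius n (A : 'M[R]_n) (lam : R) :
  A^T = A -> (forall i j, 0 <= A i j) -> (forall i j, exists N, 0 < (A ^+ N) i j) ->
  0 < lam -> eigenvalue A lam ->
  (forall a, eigenvalue A a -> a != lam -> `|a| < lam) ->
  exists (v : 'cV[R]_n) (mu : R),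
    [/\ forall k, 0 < v k 0, v^T *m v = 1%:M, A *m v = lam *: v, 0 <= mu < lam &
      forall w : 'cV[R]_n, v^T *m w = 0 -> nrm2 (A *m w) <= mu ^+ 2 * nrm2 w].
Proof.
move=> Asym A0 Airr lam0 eig_lam gap.
have [s s_eig s_bound] := symmetric_spectral_bound Asym.
have norm_le (w : 'cV_n) : nrm2 (A *m w) <= lam ^+ 2 * nrm2 w.
  apply: s_bound => [|a /s_eig eig_a]; first exact: ltW.
  by left; have [->|/(gap _ eig_a)/ltW //] := eqVneq a lam; rewrite gtr0_norm.
(* [lam |x| <= A |x|] entrywise, while [A |x|] has norm at most that of [lam |x|]. *)
have abs_eig (x : 'cV_n) : A *m x = lam *: x ->
    A *m (map_mx Num.norm x) = lam *: map_mx Num.norm x.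
  move=> Ax; set y := map_mx _ x.
  have y0 k : 0 <= y k 0 by rewrite mxE.
  have le_k k : lam * y k 0 <= (A *m y) k 0.
    have /matrixP /(_ k 0) := Ax; rewrite !mxE => Axk.
    rewrite -[lam in leLHS]gtr0_norm // -normrM -Axk.
    apply: le_trans (ler_norm_sum _ _ _) _; apply: ler_sum => j _.
    by rewrite mxE normrM ger0_norm.
  have : \sum_k ((A *m y) k 0 ^+ 2 - (lam * y k 0) ^+ 2) <= 0.
    rewrite sumrB subr_le0; have := norm_le y; rewrite !nrm2E mulr_sumr.
    under eq_bigr do rewrite big_ord1; under [X in _ <= X]eq_bigr do rewrite big_ord1.
    by under [X in _ -> _ <= X]eq_bigr do rewrite exprMn.
  have ge0 k : 0 <= (A *m y) k 0 ^+ 2 - (lam * y k 0) ^+ 2.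
    rewrite subr_ge0 lerXn2r // nnegrE ?(le_trans _ (le_k k)) //;
    by rewrite mulr_ge0 // ltW.
  move=> sum_le0; have /eqP : \sum_k ((A *m y) k 0 ^+ 2 - (lam * y k 0) ^+ 2) = 0.
    by apply/le_anti; rewrite sum_le0 /= sumr_ge0.
  rewrite psumr_eq0 // => /allP sum0; apply/colP => k.
  have := sum0 k (mem_index_enum _); rewrite /= subr_eq0 eqrXn2 //.
  - by move=> /eqP ->; rewrite [RHS]mxE.
  - by rewrite (le_trans _ (le_k k)) // mulr_ge0 // ltW.
  - by rewrite mulr_ge0 // ltW.
(* If [x j 0 != 0] and [(A ^+ N) k j > 0], then entry [k] of [A ^+ N *m y = lam ^+ N *: y] is
   positive, hence so is [y k 0]. *)
have eig_neq0 (x : 'cV_n) : A *m x = lam *: x -> x != 0 -> forall k, x k 0 != 0.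
  move=> Ax x0 k; set y := map_mx Num.norm x.
  have [j xj] : exists j, x j 0 != 0.
    apply/existsP; apply: contraR x0; rewrite negb_exists => /forallP x0.
    by apply/eqP/colP => j; have := x0 j; rewrite negbK mxE => /eqP.
  have [N AN] := Airr k j.
  have ANy M : A ^+ M *m y = lam ^+ M *: y.
    elim: M => [|M IH]; first by rewrite !expr0 mul1mx scale1r.
    by rewrite exprSr -mulmxA abs_eig // -scalemxAr IH scalerA -exprS.
  have AN0 M i i' : 0 <= (A ^+ M) i i'.
    elim: M i i' => [|M IH] i i'; first by rewrite expr0 mxE ler0n.
    by rewrite exprS mxE sumr_ge0 // => l _; rewrite mulr_ge0.
  have /colP /(_ k) := ANy N; rewrite !mxE => e; rewrite -normr_gt0.
  rewrite -(pmulr_rgt0 _ (exprn_gt0 N lam0)) -e (bigD1 j) //= ltr_pwDl //.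
    by rewrite mulr_gt0 // mxE normr_gt0.
  by apply: sumr_ge0 => l _; rewrite mulr_ge0 // mxE.
have [x /(congr1 trmx) Ax x0] : exists2 x : 'rV_n, x *m A = lam *: x & x != 0.
  exact/eigenvalueP.
rewrite trmx_mul linearZ /= Asym in Ax.
pose y := map_mx Num.norm x^T.
have Ay : A *m y = lam *: y by exact: abs_eig.
have y0 k : 0 < y k 0.
  by rewrite mxE normr_gt0 eig_neq0 // -(inj_eq trmx_inj) trmxK trmx0.
have ny0 : 0 < nrm2 y.
  rewrite lt_def nrm2_ge0 andbT; apply/eqP => /nrm2_eq0 y_eq0.
  case/negP: x0; apply/eqP/rowP => k; have := y0 k.
  by rewrite y_eq0 mxE ltxx.
pose v := (Num.sqrt (nrm2 y))^-1 *: y.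
have Av : A *m v = lam *: v by rewrite -scalemxAr Ay !scalerA mulrC.
have v0 k : 0 < v k 0 by rewrite mxE mulr_gt0 // invr_gt0 sqrtr_gt0.
have vv : v^T *m v = 1%:M.
  apply/matrixP => i j; rewrite !ord1 [RHS]mxE eqxx mulr1n.
  rewrite -trace_mx11 -/(nrm2 v) nrm2Z exprVn sqr_sqrtr ?mulVf ?gt_eqF //; exact: ltW.
(* The largest modulus among the eigenvalues other than [lam]; the maximum starts at [0] in case
   there are none. *)
clearbody v; pose mu := \big[Num.max/0]_(a <- s | a != lam) `|a|.
exists v, mu; split=> //.
  rewrite /mu big_seq_cond; apply/andP; split.
    by elim/big_rec: _ => // a z _ z0; rewrite le_max z0 orbT.
  elim/big_rec: _ => // a z /andP[/s_eig eig_a alam] z0.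
  by rewrite gt_max z0 andbT gap.
move=> w vw; apply: s_bound => [|a a_s].
  by rewrite /mu; elim/big_rec: _ => // a z _ z0; rewrite le_max z0 orbT.
have [alam|alam] := eqVneq a lam; [right=> z zA | left]; last first.
  rewrite /mu; elim: s a_s {s_eig} @mu => //= b s IH; rewrite inE big_cons.
  by move=> /predU1P[<-|/IH h]; rewrite ?alam ?le_max ?lexx //; case: ifP; rewrite ?le_max h ?orbT.
have [k _] : exists k : 'I_n, true.
  case: (pickP 'I_n) => [k _|noI]; first by exists k.
  by case/negP: x0; apply/eqP/rowP => k; have := noI k.
have Az : A *m z^T = lam *: z^T by rewrite -{1}Asym -trmx_mul zA alam linearZ.
(* With this [c], the vector [z^T - c *: v] vanishes at [k]; a nonzero eigenvector for [lam] has no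
   zero entry, so the difference is zero. *)
pose c := z 0 k / v k 0.
have zE : z^T = c *: v.
  apply/eqP; rewrite -subr_eq0; apply: contraT => /eig_neq0.
  have -> : A *m (z^T - c *: v) = lam *: (z^T - c *: v).
    by rewrite mulmxBr Az -scalemxAr Av scalerBr !scalerA [c * _]mulrC.
  by move=> /(_ erefl k); rewrite !mxE divfK ?subrr ?eqxx // gt_eqF.
by rewrite -[z]trmxK zE linearZ -scalemxAl vw scaler0.
Qed.

End Perron.

(** * Property (tau) extended to reducible unitary representations *)

Section Tau.

Variable R : realType.
Local Notation C := R[i].
Local Open Scope sesquilinear_scope.

Lemma trmxC_mul m n p (U : 'M[C]_(m, n)) (V : 'M[C]_(n, p)) :
  (U *m V)^t* = V^t* *m U^t*.
Proof. by rewrite trmx_mul map_mxM. Qed.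

Lemma cn2_dot d (u : 'cV[C]_d) : cn2 u = (u^t* *m u) 0 0.
Proof. by rewrite cn2E map_trmx. Qed.

(** Gram-Schmidt is applied to a row basis of [M] and to one of its orthogonal complement. The
    separate blocks [V1] and [V2] allow a representation to be compressed to each summand. *)
Lemma orthonormal_split d m (M : 'M[C]_(m, d)) :
  exists m1 m2 (V1 : 'M[C]_(m1, d)) (V2 : 'M[C]_(m2, d)),
    [/\ V1 *m V1^t* = 1%:M, V2 *m V2^t* = 1%:M, V1 *m V2^t* = 0 &
        V1^t* *m V1 + V2^t* *m V2 = 1%:M] /\
    [/\ (V1 :=: M)%MS, m1 = \rank M & (m1 + m2 = d)%N].
Proof.
have := schmidt_complete_unitarymx M; rewrite /schmidt_complete.
set V1 := schmidt (row_base M); set V2 := schmidt _ => U.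
have V1M : (V1 :=: M)%MS.
  apply: eqmx_trans (eq_row_base M); exact/eqmx_schmidt_free/row_base_free.
have Ud := add_rank_ortho M.
exists _, _, V1, V2; split; last by [].
have := mulmxKtV 1%:M U Ud; rewrite tr_col_mx map_row_mx mul1mx mul_row_col => V12.
have /unitarymxP := U; rewrite tr_col_mx map_row_mx mul_col_row scalar_mx_block.
by case/eq_block_mx.
Qed.

Variable G : groupType.

Section Subrepresentation.

Variables (d m : nat) (rho : G -> 'M[C]_d) (V : 'M[C]_(m, d)).
Hypotheses (rho_rep : is_rep rho) (rhoU : unitary_rep rho) (rho_fin : finite_image rho).
Hypotheses (VV : V *m V^t* = 1%:M)
  (Vrho : forall g, V *m rho g = (V *m rho g *m V^t*) *m V).

(** The compression of [rho] to the row space of [V]. The hypothesis [Vrho] says that this space is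
    stable under right multiplication by [rho g], which makes the compression multiplicative. *)
Definition subrep (g : G) : 'M[C]_m := V *m rho g *m V^t*.

Lemma subrep_rep : is_rep subrep.
Proof.
case: rho_rep => rho1 rhoM; split=> [|x y]; first by rewrite /subrep rho1 mulmx1.
by rewrite /subrep rhoM mulmxA {1}Vrho -!mulmxA.
Qed.

Lemma subrep_unitary : unitary_rep subrep.
Proof.
move=> g; rewrite map_trmx /subrep trmxC_mul trmxCK trmxC_mul !mulmxA -Vrho.
have := rhoU g; rewrite map_trmx => rr.
by rewrite -[V *m _ *m _]mulmxA rr mulmx1.
Qed.

Lemma subrep_finite : finite_image subrep.
Proof.
case: rho_fin => s sP; exists [seq V *m r *m V^t* | r <- s] => g.
exact: map_f.
Qed.

Lemma subrep_displacement g (u : 'cV[C]_d) :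
  V *m (rho g *m u - u) = subrep g *m (V *m u) - V *m u.
Proof. by rewrite mulmxBr [V *m (rho g *m u)]mulmxA Vrho -mulmxA. Qed.

End Subrepresentation.

Variables (n : nat) (t : 'I_n -> G).

(* (tau) provides one [s] depending on the representation; summing over all
   pairs [(a, b)] makes the bound stable under orthogonal direct sums. *)
Lemma irreducible_displacement (kappa : R) d (rho : G -> 'M[C]_d) (u : 'cV[C]_d) :
  0 < kappa ->
  (forall u : 'cV[C]_d, vnorm u = 1 ->
    exists s, SinvS t s /\ real_complex R kappa < vnorm (rho s *m u - u)) ->
  real_complex R (kappa ^+ 2) * cn2 u
    <= \sum_a \sum_b cn2 (rho ((t a)^-1 * t b)%g *m u - u).
Proof.
move=> kappa0 tau.
have sum0 : 0 <= \sum_a \sum_b cn2 (rho ((t a)^-1 * t b)%g *m u - u).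
  by do 2![apply: sumr_ge0 => ? _]; exact: cn2_ge0.
have [/eqP u0|u0] := eqVneq u 0.
  by move: u0; rewrite -cn2_eq0 => /eqP ->; rewrite mulr0.
have cu0 : 0 < cn2 u by rewrite lt_def cn2_eq0 u0 cn2_ge0.
pose c := (sqrtC (cn2 u))^-1.
have c2 : `|c| ^+ 2 = (cn2 u)^-1.
  by rewrite ger0_norm ?invr_ge0 ?sqrtC_ge0 ?cn2_ge0 // /c exprVn sqrtCK.
have [|s [[a [b ->]] lt_k]] := tau (c *: u).
  by rewrite /vnorm -/(cn2 _) cn2Z c2 mulVf ?sqrtC1 // gt_eqF.
have : real_complex R (kappa ^+ 2) <= cn2 (rho ((t a)^-1 * t b)%g *m (c *: u) - c *: u).
  rewrite -[leRHS]sqrtCK rmorphXn /= lerXn2r ?nnegrE ?sqrtC_ge0 ?cn2_ge0 //.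
    by rewrite ler0c ltW.
  exact: ltW.
rewrite -scalemxAr -scalerBr cn2Z c2 mulrC ler_pdivlMr // => /le_trans; apply.
rewrite (bigD1 a) //= (bigD1 b) //= -addrA lerDl addr_ge0 //.
  by apply: sumr_ge0 => ? _; exact: cn2_ge0.
by do 2![apply: sumr_ge0 => ? _]; exact: cn2_ge0.
Qed.

(* The witness is the span of an orbit, stored as the rows [(rho g u0)^t*]:
   it is finitely generated because [rho] has finite image. *)
Lemma reducible_cyclic d (rho : G -> 'M[C]_d) : (0 < d)%N ->
  is_rep rho -> finite_image rho -> ~ irreducible_rep rho ->
  exists m (M : 'M[C]_(m, d)),
    (0 < \rank M < d)%N /\ forall g, (M *m (rho g)^t* <= M)%MS.
Proof.
move=> d0 [rho1 rhoM] [s sP] nirr.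
have [W [[W0 [WD WZ]] [Winv [[u0 Wu0 u0n] [u1 Wu1]]]]] : exists W : 'cV[C]_d -> Prop,
    subspace W /\ (forall g u, W u -> W (rho g *m u)) /\
    (exists2 u0, W u0 & u0 <> 0) /\ exists u1, ~ W u1.
  apply: contrapT => noW; apply: nirr; split=> // W Wsub Winv.
  have [W1|W1] := EM (exists u1, ~ W u1).
    left=> u Wu; apply: contrapT => u0; apply: noW.
    by exists W; do 3?split=> //; exists u.
  by right=> u; apply: contrapT => Wu; apply: W1; exists u.
(* The list [s] may contain matrices that are not values of [rho]; they are discarded so that every
   row of [M] comes from the orbit. *)
pose s' := [seq r <- s | `[< exists g, rho g = r >]].
pose M := \matrix_(i < size s') ((s'`_i *m u0)^t*).
have rowM (X : 'rV_d) : (exists2 g, X = (rho g *m u0)^t* & True) -> (X <= M)%MS.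
  case=> g -> _; have gs : rho g \in s' by rewrite mem_filter sP andbT; apply/asboolP; exists g.
  have lt_i : (index (rho g) s' < size s')%N by rewrite index_mem.
  rewrite -[rho g](nth_index 0 gs).
  by rewrite -(rowK (fun i : 'I__ => (s'`_i *m u0)^t*) (Ordinal lt_i)) row_sub.
have s'E (i : 'I_(size s')) : exists g, rho g = s'`_i.
  by have := mem_nth 0 (ltn_ord i); rewrite mem_filter => /andP[/asboolP].
exists (size s'), M; split; last first.
  move=> g; apply/row_subP => i; rewrite row_mul rowK -trmxC_mul mulmxA.
  by have [h <-] := s'E i; apply: rowM; exists (g * h)%g; rewrite ?rhoM.
apply/andP; split.
  rewrite lt0n mxrank_eq0; apply/eqP => M0; apply: u0n.
  have : (u0^t* <= M)%MS by apply: rowM; exists 1%g => //; rewrite rho1 mul1mx.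
  by rewrite M0 => /submx0null /(congr1 (fun X => X^t*)); rewrite trmxCK trmx0 map_mx0.
(* If the orbit spanned everything, [u1] would be a linear combination of vectors of [W]. *)
rewrite ltnNge; apply/negP => rankM; apply: Wu1.
have /submxP[X u1E] : (u1^t* <= M)%MS.
  by apply: submx_full; rewrite /row_full eqn_leq rank_leq_col.
rewrite -[u1]trmxCK u1E mulmx_sum_row.
pose W' (z : 'rV[C]_d) := W (z^t*).
rewrite -/(W' _); elim/big_ind: _ => [|x y Wx Wy|i _].
- by rewrite /W' trmx0 map_mx0.
- by rewrite /W' linearD map_mxD; exact: WD.
rewrite rowK /W' linearZ map_mxZ trmxCK; apply: WZ.
by have [h <-] := s'E i; exact: Winv.
Qed.

(** Induction on the dimension: a reducible representation splits orthogonally into two smaller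
    ones, and both sides of the inequality are additive. Orthogonality to the invariant vectors is
    inherited by the two components of [u]. *)
Lemma unitary_displacement (kappa : R) : 0 < kappa ->
  (forall (d : nat) (rho : G -> 'M[C]_d),
    is_rep rho -> unitary_rep rho -> finite_image rho ->
    irreducible_rep rho -> nontrivial_rep rho ->
    forall u : 'cV[C]_d, vnorm u = 1 ->
      exists s : G, SinvS t s /\ real_complex R kappa < vnorm (rho s *m u - u)) ->
  forall d (rho : G -> 'M[C]_d), is_rep rho -> unitary_rep rho -> finite_image rho ->
  forall u : 'cV[C]_d, (forall w : 'cV[C]_d, (forall g, rho g *m w = w) -> w^t* *m u = 0) ->
  real_complex R (kappa ^+ 2) * cn2 u
    <= \sum_a \sum_b cn2 (rho ((t a)^-1 * t b)%g *m u - u).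
Proof.
move=> kappa0 tau d; have [k] := ubnP d.
elim: k d => // k IH d /ltnSE ledk rho rhoR rhoU rhoF u u_inv.
have sum0 : 0 <= \sum_a \sum_b cn2 (rho ((t a)^-1 * t b)%g *m u - u).
  by do 2![apply: sumr_ge0 => ? _]; exact: cn2_ge0.
have [d0|d0] := posnP d.
  rewrite (_ : cn2 u = 0) ?mulr0 //; apply: big1 => i _.
  by have := ltn_ord i; rewrite {2}d0.
have [irr|nirr] := EM (irreducible_rep rho).
  have [nontriv|triv] := EM (nontrivial_rep rho).
    by apply: irreducible_displacement => //; exact: tau.
  (* If the action is trivial, [u] itself is invariant, hence orthogonal to itself. *)
  rewrite (_ : cn2 u = 0) ?mulr0 // cn2_dot u_inv ?mxE // => g.
  have -> : rho g = 1%:M; last by rewrite mul1mx.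
  by apply: contrapT => /eqP rg; apply: triv; exists g.
have [m [M [/andP[M0 Md] Minv]]] := reducible_cyclic d0 rhoR rhoF nirr.
have [m1 [m2 [V1 [V2 [[V11 V22 V12 Vsum] [V1M m1E m12]]]]]] := orthonormal_split M.
have [rho1 rhoM] := rhoR.
have rhoV g : (rho g)^t* = rho (g^-1)%g.
  have rr : rho g *m (rho g)^t* = 1%:M by rewrite -map_trmx rhoU.
  by rewrite -[LHS]mul1mx -rho1 -(mulVg g) rhoM -mulmxA rr mulmx1.
have rho1E g : V1 *m rho g = V1 *m rho g *m V1^t* *m V1.
  have /submxP[X XE] : (V1 *m rho g <= V1)%MS.
    have : (M *m rho g <= M)%MS by have := Minv g^-1%g; rewrite rhoV invgK.
    by rewrite (eqmxMr (rho g) V1M) V1M.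
  by rewrite XE -[X *m V1 *m _]mulmxA V11 mulmx1.
have V21 : V2 *m V1^t* = 0 by rewrite -[V2]trmxCK -trmxC_mul V12 trmx0 map_mx0.
have rho120 g : V1 *m rho g *m V2^t* = 0 by rewrite rho1E -mulmxA V12 mulmx0.
(* The complement is invariant too: this is the adjoint of [rho120] at [g^-1]. *)
have rho210 g : V2 *m rho g *m V1^t* = 0.
  rewrite -[V2]trmxCK -[rho g]trmxCK rhoV -!trmxC_mul mulmxA rho120.
  by rewrite trmx0 map_mx0.
have rho2E g : V2 *m rho g = V2 *m rho g *m V2^t* *m V2.
  by rewrite -[LHS]mulmx1 -Vsum mulmxDr !mulmxA rho210 mul0mx add0r.
have cn2_split (w : 'cV[C]_d) : cn2 w = cn2 (V1 *m w) + cn2 (V2 *m w).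
  rewrite !cn2_dot !trmxC_mul.
  have -> : w^t* *m w = w^t* *m V1^t* *m (V1 *m w) + w^t* *m V2^t* *m (V2 *m w).
    by rewrite -{2}[w]mul1mx -Vsum mulmxDl mulmxDr !mulmxA.
  by rewrite mxE.
rewrite cn2_split mulrDr.
under eq_bigr => a _ do under eq_bigr => b _ do
  rewrite cn2_split (subrep_displacement rho1E) (subrep_displacement rho2E).
under eq_bigr => a _ do rewrite big_split.
rewrite big_split /=; apply: lerD; apply: IH.
- by rewrite m1E (leq_trans Md).
- exact: subrep_rep.
- exact: subrep_unitary.
- exact: subrep_finite.
(* A vector [w] fixed by the compression yields the vector [V1^t* *m w] fixed by [rho], to which
   [u_inv] applies. *)
- move=> w w_inv; rewrite mulmxA -[V1]trmxCK -trmxC_mul; apply: u_inv => g.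
  rewrite -[LHS]mul1mx -Vsum mulmxDl -!mulmxA [V2 *m _]mulmxA [V2 *m _ *m _]mulmxA rho210.
  by rewrite mul0mx mulmx0 addr0 [V1 *m _]mulmxA [V1 *m _ *m _]mulmxA w_inv.
- by rewrite (leq_trans _ ledk) // -m12 -[X in (X < _)%N]add0n ltn_add2r m1E.
- exact: subrep_rep.
- exact: subrep_unitary.
- exact: subrep_finite.
move=> w w_inv; rewrite mulmxA -[V2]trmxCK -trmxC_mul; apply: u_inv => g.
rewrite -[LHS]mul1mx -Vsum mulmxDl -!mulmxA [V1 *m _]mulmxA [V1 *m _ *m _]mulmxA rho120.
by rewrite mul0mx mulmx0 add0r [V2 *m _]mulmxA [V2 *m _ *m _]mulmxA w_inv.
Qed.

End Tau.

(** * The permutation representation of a transitive action *)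

Section Regular.

Variables (R : realType) (G : groupType) (q : nat) (sigma : G -> 'I_q -> 'I_q).
Hypotheses (sigma1 : forall y, sigma 1%g y = y)
  (sigmaM : forall g h y, sigma (g * h)%g y = sigma h (sigma g y))
  (sigma_trans : forall x y, exists g, sigma g x = y).

(** Composition of functions with [sigma g]. It is a left representation because [sigma] is a right
    action by [sigmaM]. *)
Definition permrep (K : pzRingType) (g : G) : 'M[K]_q := \matrix_(y, x) (x == sigma g y)%:R.

Lemma permrep_mulE (K : pzRingType) m g (F : 'M[K]_(q, m)) y j :
  (permrep K g *m F) y j = F (sigma g y) j.
Proof.
rewrite mxE (bigD1 (sigma g y)) //= mxE eqxx mul1r big1 ?addr0 // => x.
by rewrite mxE => /negPf ->; rewrite mul0r.
Qed.

Lemma mul_trpermrepE (K : pzRingType) m g (F : 'M[K]_(m, q)) i y :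
  (F *m (permrep K g)^T) i y = F i (sigma g y).
Proof.
rewrite mxE (bigD1 (sigma g y)) //= !mxE eqxx mulr1 big1 ?addr0 // => x.
by rewrite !mxE => /negPf ->; rewrite mulr0.
Qed.

Lemma permrep1 (K : pzRingType) : permrep K 1%g = 1%:M.
Proof. by apply/matrixP => y x; rewrite !mxE sigma1 eq_sym. Qed.

Lemma permrepM (K : pzRingType) g h : permrep K (g * h)%g = permrep K g *m permrep K h.
Proof. by apply/matrixP => y x; rewrite permrep_mulE !mxE sigmaM. Qed.

Lemma trmx_permrep (K : pzRingType) g : (permrep K g)^T = permrep K (g^-1)%g.
Proof.
apply/matrixP => y x; rewrite !mxE; congr (nat_of_bool _)%:R.
by apply/eqP/eqP => ->; rewrite -sigmaM ?mulgV ?mulVg sigma1.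
Qed.

Lemma permrep_orth (K : pzRingType) g : permrep K g *m (permrep K g)^T = 1%:M.
Proof. by rewrite trmx_permrep -permrepM mulgV permrep1. Qed.

Lemma sum_permrep (g : G) (f : 'I_q -> R) : \sum_x f (sigma g x) = \sum_x f x.
Proof.
rewrite [RHS](reindex (sigma g)) //.
by exists (sigma g^-1%g) => x _; rewrite -sigmaM ?mulgV ?mulVg sigma1.
Qed.

(** By transitivity the invariant vectors are constant, hence orthogonal to [h]. Applying the
    isometry of [t a] turns the displacement by [(t a)^-1 * t b] into the difference of the
    translates by [t b] and [t a]. *)
Lemma regular_displacement n (t : 'I_n -> G) (kappa : R) : 0 < kappa ->
  (forall (d : nat) (rho : G -> 'M[R[i]]_d),
    is_rep rho -> unitary_rep rho -> finite_image rho ->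
    irreducible_rep rho -> nontrivial_rep rho ->
    forall u : 'cV[R[i]]_d, vnorm u = 1 ->
      exists s : G, SinvS t s /\ real_complex R kappa < vnorm (rho s *m u - u)) ->
  forall h : 'rV[R]_q, \sum_x h 0 x = 0 ->
  kappa ^+ 2 * nrm2 h <=
    \sum_a \sum_b nrm2 (h *m (permrep R (t a))^T - h *m (permrep R (t b))^T).
Proof.
move=> kappa0 tau h h0; pose u := map_mx (real_complex R) h^T.
have conj_perm g : map_mx Num.conj (permrep R[i] g) = permrep R[i] g.
  by apply/matrixP => y x; rewrite !mxE rmorph_nat.
have repP : is_rep (permrep R[i]) by split; [exact: permrep1 | exact: permrepM].
have repU : unitary_rep (permrep R[i]) by move=> g; rewrite conj_perm; exact: permrep_orth.
have repF : finite_image (permrep R[i]).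
  exists [seq \matrix_(y, x) (x == f y)%:R | f : {ffun 'I_q -> 'I_q}] => g.
  apply/mapP; exists [ffun y => sigma g y]; first by rewrite mem_enum.
  by apply/matrixP => y x; rewrite !mxE ffunE.
have H := unitary_displacement kappa0 tau repP repU repF (u := u).
rewrite -(nrm2_tr h) -lecR [real_complex R (_ * nrm2 _)]rmorphM /= -cn2_real [leRHS]rmorph_sum.
apply: le_trans (H _) _ => {H} [w w_inv|].
  have w_const x y : w x 0 = w y 0.
    by have [g <-] := sigma_trans x y; rewrite -permrep_mulE w_inv.
  apply/matrixP => i j; rewrite !ord1 !mxE.
  case: (pickP 'I_q) => [x0 _|noI]; last by apply: big1 => x; have := noI x.
  under eq_bigr => x _ do rewrite !mxE (w_const x x0).
  by rewrite -mulr_sumr -rmorph_sum h0 rmorph0 mulr0.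
apply: ler_sum => a _; rewrite rmorph_sum; apply: ler_sum => b _ /=.
rewrite -[X in real_complex R X]nrm2_tr -cn2_real; set D := _ *m u - u.
rewrite -[cn2 D](cn2_isometry (U := permrep R[i] (t a))); last first.
  by rewrite conj_perm trmx_permrep -permrepM mulVg permrep1.
rewrite mulmxBr mulmxA -permrepM mulgA mulgV mul1g.
rewrite /cn2 le_eqVlt; apply/orP; left; apply/eqP; apply: eq_bigr => y _.
rewrite mxE [(- (_ *m u)) y 0]mxE !permrep_mulE -normrN opprB; congr (`|_| ^+ 2).
rewrite [RHS]mxE [_^T _ _]mxE [(h *m _ - _) 0 y]mxE [(- (h *m _)) 0 y]mxE !mul_trpermrepE.
by rewrite !mxE -rmorphB.
Qed.

End Regular.

(** * Decay from two-step contraction and growth of the number of walks *)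

(** Here [y] is a squared norm, so two steps contribute [(c * lam) ^+ 4]. The induction carries two
    consecutive indices; the factor [c^-1] absorbs the first step, where only growth by [lam] is
    known. *)
Lemma two_step_decay (R : realFieldType) (y : nat -> R) (lam c : R) :
  0 < lam -> 0 < c < 1 -> y 0%N <= 1 -> y 1%N <= lam ^+ 2 * y 0%N ->
  (forall N, y N.+2 <= c ^+ 4 * lam ^+ 4 * y N) ->
  forall N, y N <= (c^-1 * (c * lam) ^+ N) ^+ 2.
Proof.
move=> lam0 /andP[c0 c1] y0 y1 yS N.
have cV : 1 <= c^-1 by rewrite invf_ge1 // ltW.
suff [] : y N <= (c^-1 * (c * lam) ^+ N) ^+ 2 /\ y N.+1 <= (c^-1 * (c * lam) ^+ N.+1) ^+ 2 by [].
elim: N => [|N [IH0 IH1]]; split=> //.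
- by rewrite expr0 mulr1 (le_trans y0) // exprn_ege1.
- rewrite expr1 mulKf ?gt_eqF // (le_trans y1) //.
  by rewrite -[leRHS]mulr1 ler_wpM2l // exprn_ge0 // ltW.
apply: le_trans (yS N) _.
have cl0 : 0 <= c ^+ 4 * lam ^+ 4 by rewrite mulr_ge0 // exprn_ge0 // ltW.
apply: (le_trans (ler_wpM2l cl0 IH0)).
by rewrite !exprS !exprMn le_eqVlt; apply/orP; left; apply/eqP; ring.
Qed.

Lemma nwalks_expmx (R : pzRingType) n (A : 'M[nat]_n) N (i j : 'I_n) :
  (nwalks A N i j)%:R = (map_mx (fun k : nat => k%:R : R) A ^+ N) i j.
Proof.
elim: N i => [|N IH] i; first by rewrite /nwalks nwalks_P0 andbT expr0 mxE.
rewrite /nwalks nwalks_P_recl exprS mxE natr_sum; apply: eq_bigr => k _.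
by rewrite mxE natrM -IH.
Qed.

Lemma leq_nwalks_P n (A : 'M[nat]_n) N (i j : 'I_n) (P : {ffun 'I_N.+1 -> 'I_n} -> bool) :
  (nwalks_P A i j P <= nwalks A N i j)%N.
Proof.
rewrite /nwalks /nwalks_P big_mkcond [leqRHS]big_mkcond leq_sum // => w _.
by case: (w ord0 == i); case: (w ord_max == j); case: (P w).
Qed.

(** The basis vector at [j] is [v j 0 *: v + z]: the first term is scaled by [lam ^+ N], and the
    second, orthogonal to [v], by at most [mu ^+ N] in norm. *)
Lemma growth_estimate (R : realFieldType) n (A : 'M[R]_n) (lam mu : R) (v : 'cV[R]_n) i j N :
  A^T = A -> v^T *m v = 1%:M -> A *m v = lam *: v -> 0 <= mu ->
  (forall w : 'cV[R]_n, v^T *m w = 0 -> nrm2 (A *m w) <= mu ^+ 2 * nrm2 w) ->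
  `|(A ^+ N) i j - lam ^+ N * (v i 0 * v j 0)| <= mu ^+ N.
Proof.
move=> Asym vv Av mu0 gap.
pose e : 'cV[R]_n := delta_mx j 0; pose z := e - v *m (v^T *m e).
have vz : v^T *m z = 0 by rewrite mulmxBr [v^T *m (v *m _)]mulmxA vv mul1mx subrr.
have nz : nrm2 z <= 1.
  have : nrm2 e = 1.
    rewrite nrm2E (bigD1 j) //= [X in _ + X]big1 => [|k kj].
      by rewrite big_ord1 mxE !eqxx expr1n addr0.
    by rewrite big_ord1 mxE (negPf kj) expr0n.
  by rewrite (nrm2_proj e vv) => <-; rewrite lerDr nrm2_ge0.
have ANz M : v^T *m (A ^+ M *m z) = 0 /\ nrm2 (A ^+ M *m z) <= (mu ^+ M) ^+ 2.
  elim: M => [|M [IH0 IH]]; first by rewrite !expr0 mul1mx expr1n.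
  rewrite exprS -mulmxA mulmxA (trv_mulA Asym Av) -scalemxAl IH0 scaler0; split=> //.
  apply: le_trans (gap _ IH0) _; rewrite [mu ^+ M.+1]exprS exprMn ler_wpM2l // sqr_ge0 //.
have ANv M : A ^+ M *m v = lam ^+ M *: v.
  elim: M => [|M IH]; first by rewrite !expr0 mul1mx scale1r.
  by rewrite exprSr -mulmxA Av -scalemxAr IH scalerA -exprS.
have -> : (A ^+ N) i j - lam ^+ N * (v i 0 * v j 0) = (A ^+ N *m z) i 0.
  have eA : (A ^+ N *m e) i 0 = (A ^+ N) i j by rewrite -colE mxE.
  have ev : ((lam ^+ N *: v) *m (v^T *m e)) i 0 = lam ^+ N * (v i 0 * v j 0).
    by rewrite mxE big_ord1 -colE !mxE mulrA.
  rewrite mulmxBr [A ^+ N *m (v *m _)]mulmxA ANv.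
  by rewrite mxE [(- ((lam ^+ N *: v) *m _)) i 0]mxE eA ev.
rewrite -(ger0_norm (exprn_ge0 N mu0)) -ler_sqr ?nnegrE // !real_normK ?num_real //.
exact: le_trans (nrm2_entry _ _ _) (ANz N).2.
Qed.

(** * Label counts as vectors indexed by the finite image of [psi] *)

Section WalkVector.

Variables (R : realType) (n : nat) (A : 'M[nat]_n) (Gamma Gamma' : groupType).
Variables (t : 'I_n -> Gamma) (psi : Gamma -> Gamma') (img : seq Gamma').
Hypotheses (psiM : is_group_hom psi) (img_uniq : uniq img).
Hypothesis imgP : forall x, x \in img <-> exists g, psi g = x.

Local Notation q := (size img).
Local Notation AR := (map_mx (fun k : nat => k%:R : R) A).

Lemma hom1 : psi 1%g = 1%g.
Proof. by apply: (mulgI (psi 1%g)); rewrite -psiM !mulg1. Qed.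

Lemma homV g : psi g^-1%g = (psi g)^-1%g.
Proof. by apply: (mulgI (psi g)); rewrite -psiM !mulgV hom1. Qed.

Lemma nth_img (x : 'I_q) : exists g, psi g = nth 1%g img x.
Proof. by apply/imgP; rewrite mem_nth. Qed.

Lemma shift_subproof g (y : 'I_q) : (index ((psi g)^-1 * nth 1 img y)%g img < q)%N.
Proof.
rewrite index_mem; apply/imgP; have [h <-] := nth_img y.
by exists (g^-1 * h)%g; rewrite psiM homV.
Qed.

(** Left translation by [(psi g)^-1] on positions in [img]: deleting a first label [g] divides by
    [psi g] on the left. The inverse makes this a right action, as [permrep] requires. *)
Definition shift g (y : 'I_q) : 'I_q := Ordinal (shift_subproof g y).

Lemma nth_shift g y : nth 1%g img (shift g y) = ((psi g)^-1 * nth 1 img y)%g.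
Proof. by rewrite nth_index // -index_mem shift_subproof. Qed.

Lemma nth_img_inj (x y : 'I_q) : nth 1%g img x = nth 1%g img y -> x = y.
Proof. by move=> /eqP; rewrite nth_uniq // => /eqP xy; apply/val_inj. Qed.

Lemma shift1 y : shift 1%g y = y.
Proof. by apply: nth_img_inj; rewrite nth_shift hom1 invg1 mul1g. Qed.

Lemma shiftM g h y : shift (g * h)%g y = shift h (shift g y).
Proof. by apply: nth_img_inj; rewrite !nth_shift psiM invgM mulgA. Qed.

Lemma shift_trans x y : exists g, shift g x = y.
Proof.
have [[g gx] [h hy]] := (nth_img x, nth_img y).
exists (g * h^-1)%g; apply: nth_img_inj.
by rewrite nth_shift -gx -hy psiM homV invgM invgK mulgVK.
Qed.

Variable j : 'I_n.

Definition label_count N (i : 'I_n) (x : 'I_q) : nat :=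
  nwalks_P A i j (fun w : {ffun 'I_N.+1 -> 'I_n} => psi (walk_label t w) == nth 1%g img x).

(** The first factor of the label is [t i], whatever the next vertex [k], so a single shift serves
    all terms of the sum. *)
Lemma label_countS N i x :
  (label_count N.+1 i x = \sum_k A i k * label_count N k (shift (t i) x))%N.
Proof.
rewrite /label_count nwalks_P_recl; apply: eq_bigr => k _; congr (_ * _)%N.
apply: eq_nwalks_P => w; rewrite walk_label_fcons psiM nth_shift.
by apply/eqP/eqP => [<-|->]; rewrite ?mulKg ?mulVKg.
Qed.

(** Centred counts rather than probabilities: division by the number of walks, which varies with [N]
    and [i], would spoil the linear recursion. *)
Definition deviation N : 'M[R]_(n, q) :=
  \matrix_(i, x) ((label_count N i x)%:R - (nwalks A N i j)%:R / q%:R).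

(** Transposed because functions of the label are stored as rows and multiplied on the right. *)
Definition shift_mx (k : 'I_n) : 'M[R]_q := (permrep shift R (t k))^T.

(** The subtracted uniform part is constant in [x], so shifts do not affect it and it follows the
    recursion for the total counts. *)
Lemma deviationS N : deviation N.+1 = rowact shift_mx (AR *m deviation N).
Proof.
apply/matrixP => i x; rewrite [RHS]mxE mul_trpermrepE !mxE.
rewrite label_countS /nwalks nwalks_P_recl -/(nwalks _ _ _ _) !natr_sum mulr_suml -sumrB.
by apply: eq_bigr => k _; rewrite !mxE !natrM mulrBr mulrA.
Qed.

Lemma img1 : 1%g \in img.
Proof. by apply/imgP; exists 1%g; exact: hom1. Qed.

Lemma size_img_gt0 : (0 < q)%N.
Proof. by case: img img1. Qed.

Lemma label_count0 i (x : 'I_q) : label_count 0 i x = ((i == j) && (nth 1%g img x == 1%g)).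
Proof. by rewrite /label_count nwalks_P0 /walk_label big_ord0 hom1 eq_sym [1%g == _]eq_sym. Qed.

Definition img_one : 'I_q := Ordinal (etrans (index_mem 1%g img) img1).

Lemma nth_img_eq1 (x : 'I_q) : (nth 1%g img x == 1%g) = (x == img_one).
Proof.
have n1 : nth 1%g img img_one = 1%g by rewrite nth_index ?img1.
by apply/eqP/eqP => [x1|->]; [apply: nth_img_inj; rewrite n1|].
Qed.

(** The recursion preserves mean zero, since [A] combines rows linearly and each shift permutes the
    entries of a row. This is the condition under which [regular_displacement] applies. *)
Lemma sum_deviation N i : \sum_x deviation N i x = 0.
Proof.
have q0 : q%:R != 0 :> R by rewrite pnatr_eq0 -lt0n size_img_gt0.
elim: N i => [|N IH] i.
  under eq_bigr do rewrite mxE label_count0 nth_img_eq1 /nwalks nwalks_P0 andbT.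
  rewrite sumrB sumr_const card_ord -[_ *+ q]mulr_natr divfK //.
  rewrite (bigD1 img_one) //= eqxx andbT big1 => [|x /negPf ->]; last by rewrite andbF.
  by rewrite addr0 subrr.
rewrite deviationS.
under eq_bigr => x _ do rewrite mxE mul_trpermrepE.
rewrite (sum_permrep shift1 shiftM (t i) (fun x => row i (AR *m deviation N) 0 x)).
under eq_bigr => x _ do rewrite !mxE.
rewrite exchange_big big1 // => k _ /=.
by rewrite -mulr_sumr IH mulr0.
Qed.

(** Only row [j] can be nonzero: it is the point mass at the identity minus the uniform
    distribution, of squared norm [1 - q^-1]. The bound is thus independent of the image. *)
Lemma nrm2_deviation0 : nrm2 (deviation 0) <= 1.
Proof.
have q0 : 0 < q%:R :> R by rewrite ltr0n size_img_gt0.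
rewrite nrm2E (bigD1 j) //= [X in _ + X]big1 => [|i ij]; last first.
  apply: big1 => x _.
  by rewrite mxE label_count0 /nwalks nwalks_P0 (negPf ij) /= mul0r subrr expr0n.
rewrite addr0.
under eq_bigr do rewrite mxE label_count0 nth_img_eq1 /nwalks nwalks_P0 eqxx /= mul1r.
rewrite (eq_bigr (fun x => (x == img_one)%:R * (1 - 2 / q%:R) + q%:R^-2)); last first.
  by move=> x _; case: (x == img_one) => /=; field; rewrite gt_eqF.
rewrite big_split /= sumr_const card_ord (bigD1 img_one) //= eqxx big1 => [|x /negPf ->];
  last by rewrite mul0r.
rewrite -[q%:R^-2 *+ q]mulr_natr addr0 mul1r [leLHS](_ : _ = 1 - q%:R^-1);
  last by field; rewrite gt_eqF.
by rewrite gerBl invr_ge0 ltW.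
Qed.

End WalkVector.

(** * Choice of the constants and uniform exponential convergence *)

Theorem theoremB (R : realType) (n : nat) (A : 'M[nat]_n)
    (Gamma : groupType) (t : 'I_n -> Gamma) :
  A^T = A ->
  connected_adj A ->
  PF_gap R A ->
  generates (SinvS t) ->
  property_tau_finite R (SinvS t) ->
  exists C c : R, 0 < C /\ 0 < c < 1 /\
    forall (Gamma' : groupType) (psi : Gamma -> Gamma') (img : seq Gamma'),
      is_group_hom psi ->
      uniq img ->
      (forall x : Gamma', x \in img <-> exists g : Gamma, psi g = x) ->
      forall (i j : 'I_n) (N : nat), (1 <= N)%N ->
      forall nu : Gamma', nu \in img ->
        `|pwalk R A t psi N i j nu - (size img)%:R^-1| <= C * c ^+ N.
Proof.
move=> Asym Aconn [lam [lam0 [eig_lam gap]]] _ [kappa [kappa0 tau]].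
set AR := map_mx _ A in eig_lam gap.
have ARsym : AR^T = AR by rewrite /AR map_trmx Asym.
have AR0 i j : 0 <= AR i j by rewrite mxE ler0n.
have ARirr i j : exists N, 0 < (AR ^+ N) i j.
  by have [N W0] := Aconn i j; exists N; rewrite -nwalks_expmx ltr0n.
have [v [mu [v0 vv Av /andP[mu0 mulam] mugap]]] :=
  perron_frobenius ARsym AR0 ARirr lam0 eig_lam gap.
pose eps := \big[Num.min/1]_k v k 0 ^+ 2.
have eps0 : 0 < eps.
  rewrite /eps; elim/big_ind: _ => // [x y x0 y0|k _]; first by rewrite lt_min x0.
  exact: exprn_gt0.
have epsv k : eps <= v k 0 ^+ 2 by rewrite /eps bigmin_le.
have [eta /andP[eta0 eta1] contr] := two_step_contraction ARsym vv Av mu0 mulam mugap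
  eps0 epsv (exprn_gt0 2 kappa0).
(* [eta] controls the squared norm over two steps, hence the fourth root for the rate of the norm
   per step. *)
pose c0 := Num.sqrt (Num.sqrt eta).
have c00 : 0 < c0 by rewrite !sqrtr_gt0.
have c04 : c0 ^+ 4 = eta by rewrite (exprM _ 2 2) !sqr_sqrtr ?sqrtr_ge0 // ltW.
have c01 : c0 < 1 by rewrite -(expr_lt1 (n := 4)) ?c04 // ltW.
have ml0 : 0 <= mu / lam by rewrite divr_ge0 // ltW.
(* The rate [c0] governs large [N], and [mu / lam] the range where the main term of the walk count
   does not yet dominate. *)
pose c := Num.max c0 (mu / lam).
have c_gt0 : 0 < c by rewrite lt_max c00.
(* The factor [c0^-1] comes from [two_step_decay], and [2 / eps] from the lower bound
   [lam ^+ N * (eps / 2)] for the number of walks. *)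
pose C := 2 / (c0 * eps).
exists C, c; split; first by rewrite divr_gt0 // mulr_gt0.
split; first by rewrite c_gt0 gt_max c01 ltr_pdivrMr // mul1r.
move=> Gamma' psi img psiM img_uniq imgP i j N _ nu nu_img.
have q0 := size_img_gt0 psiM imgP.
pose x : 'I_(size img) := Ordinal (etrans (index_mem nu img) nu_img).
pose Y := deviation R A t psi img j.
have Y_bound : `|Y N i x| <= c0^-1 * (c0 * lam) ^+ N.
  rewrite -[leRHS]ger0_norm; last by rewrite mulr_ge0 ?invr_ge0 ?exprn_ge0 ?mulr_ge0 // ltW.
  rewrite -ler_sqr ?nnegrE // !real_normK ?num_real //.
  apply: le_trans (nrm2_entry _ _ _) _.
  have YS M : Y M.+1 = rowact (shift_mx R t psiM imgP) (AR *m Y M).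
    exact: deviationS.
  have orth k : shift_mx R t psiM imgP k *m (shift_mx R t psiM imgP k)^T = 1%:M.
    rewrite trmxK; apply: mulmx1C; apply: permrep_orth.
      exact: shift1.
    exact: shiftM.
  apply: (two_step_decay (y := fun M => nrm2 (Y M))) => //.
  - by rewrite c00.
  - exact: nrm2_deviation0.
  - rewrite YS nrm2_rowact //.
    apply: le_trans (nrm2_mulA_le ARsym vv Av mugap _) _.
    have := nrm2_proj (Y 0%N) vv; set p := nrm2 (v^T *m _) => YE.
    have p_le : p <= nrm2 (Y 0%N) by rewrite YE lerDl nrm2_ge0.
    have mulam2 : mu ^+ 2 <= lam ^+ 2 by rewrite ler_pXn2r // ?nnegrE ltW.
    nra.
  (* The outermost row action is an isometry; what remains is [A D A], as in
     [two_step_contraction]. *)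
  move=> M; rewrite [Y M.+2]YS nrm2_rowact // YS c04; apply: contr => //.
  apply: regular_displacement => //.
  - exact: shift1.
  - exact: shiftM.
  - exact: shift_trans.
  rewrite (eq_bigr (fun x => \sum_k v k 0 * Y M k x)); last first.
    by move=> y _; rewrite mxE; apply: eq_bigr => k _; rewrite mxE.
  rewrite exchange_big big1 // => k _ /=.
  by rewrite -mulr_sumr sum_deviation ?mulr0.
set W := nwalks A N i j.
have pE : pwalk R A t psi N i j nu = (label_count A t psi j N i x)%:R / W%:R.
  rewrite /pwalk -/W /label_count /= (_ : nth _ _ _ = nu) //.
  by rewrite nth_index.
(* There may be no walk for small [N]; the quotient is then [0], since the inverse of [0] is [0]. *)
have p01 : 0 <= pwalk R A t psi N i j nu <= 1.
  rewrite pE divr_ge0 ?ler0n //=; have [->|W0] := posnP W; first by rewrite invr0 mulr0.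
  by rewrite ler_pdivrMr ?ltr0n // mul1r ler_nat leq_nwalks_P.
have qV01 : 0 <= ((size img)%:R^-1 : R) <= 1.
  by rewrite invr_ge0 ler0n invf_le1 ?ltr0n // ler1n.
have vij : eps <= v i 0 * v j 0.
  rewrite -ler_sqr ?nnegrE ?mulr_ge0 ?(ltW eps0) ?(ltW (v0 _)) //.
  by rewrite expr2 exprMn ler_pM // ltW.
have W_lower : lam ^+ N * eps - mu ^+ N <= W%:R.
  have := growth_estimate i j N ARsym vv Av mu0 mugap.
  rewrite -nwalks_expmx -/W ler_norml => /andP[+ _].
  have : lam ^+ N * eps <= lam ^+ N * (v i 0 * v j 0) by rewrite ler_wpM2l // exprn_ge0 // ltW.
  lra.
have lamN0 : 0 < lam ^+ N by exact: exprn_gt0.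
(* When [mu ^+ N] is at most half of [lam ^+ N * eps], the number of walks is at least the other
   half and the bound on [Y] can be divided by it. *)
have [mu_small|mu_big] := leP (mu ^+ N) (lam ^+ N * (eps / 2)).
  have W_half : lam ^+ N * (eps / 2) <= W%:R by lra.
  have e20 : 0 < lam ^+ N * (eps / 2) by rewrite mulr_gt0 ?divr_gt0.
  have W0 : 0 < W%:R :> R by exact: lt_le_trans W_half.
  have -> : pwalk R A t psi N i j nu - (size img)%:R^-1 = Y N i x / W%:R.
    rewrite pE mxE -/W; field.
    by rewrite gt_eqF // pnatr_eq0 -lt0n q0.
  rewrite normrM normfV [`|W%:R|]gtr0_norm // ler_pdivrMr //.
  apply: le_trans Y_bound _.
  apply: (@le_trans _ _ (C * c0 ^+ N * (lam ^+ N * (eps / 2)))).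
    rewrite exprMn /C le_eqVlt; apply/orP; left; apply/eqP; field.
    by rewrite !gt_eqF.
  have C0 : 0 <= C by rewrite divr_ge0 // mulr_ge0 // ltW.
  apply: ler_pM => //; [by rewrite mulr_ge0 // exprn_ge0 // ltW | exact: ltW |].
  have c0c : c0 <= c by rewrite le_max lexx.
  by rewrite ler_wpM2l // lerXn2r // nnegrE ltW.
(* In the remaining case [(mu / lam) ^+ N] exceeds [eps / 2], so [C * c ^+ N] is at least
   [C * (eps / 2) = c0^-1], and the trivial bound [1] suffices. *)
have : `|pwalk R A t psi N i j nu - (size img)%:R^-1| <= 1 by rewrite ler_norml; lra.
move=> /le_trans; apply.
have cN : (mu / lam) ^+ N <= c ^+ N.
  have mlc : mu / lam <= c by rewrite le_max lexx orbT.
  by rewrite lerXn2r // nnegrE ltW.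
have : eps / 2 <= (mu / lam) ^+ N.
  by rewrite exprMn exprVn ler_pdivlMr // mulrC ltW.
move=> /le_trans /(_ cN) epsc.
have : C * (eps / 2) <= C * c ^+ N by rewrite ler_wpM2l // divr_ge0 // mulr_ge0 // ltW.
apply: le_trans; rewrite [leRHS](_ : _ = c0^-1); last by rewrite /C; field; rewrite !gt_eqF.
by rewrite invf_ge1 // ltW.
Qed.
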